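(* For an integer $p\ge 2$, let $\Psi_p$ be the smallest number such that $\mathrm{id}^{\leq p}(G)\leq \left\lceil \frac{|E(G)|}{\lfloor p/2\rfloor}\right\rceil+\Psi_p$ for every graph $G$. Then $\Psi_p=0$ for $p\in\{2,3,4,5\}$, and $\Psi_p=1$ for $p\in\{6,7,8,9\}$.
   Context: All graphs are finite and simple. For an oriented graph $D$ and a set $X\subseteq V(D)$, the inversion of $X$ reverses the orientation of every arc with both endvertices in $X$. For an integer $p\ge 2$, a $(\leq p)$-inversion is the inversion of a set of at most $p$ vertices. For a graph $G$, $\mathrm{id}^{\leq p}(G)$ (the $(\leq p)$-inversion diameter) is the maximum, over all ordered pairs $(\vec G_1,\vec G_2)$ of orientations of $G$ (on the same labelled vertex set), of the minimum number of $(\leq p)$-inversions whose successive application transforms $\vec G_1$ into $\vec G_2$. *)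

(* Defs.v *)
From mathcomp Require Import all_boot all_algebra.
Set Implicit Arguments. Unset Strict Implicit. Unset Printing Implicit Defensive.

Definition simple_graph (T : finType) (e : rel T) : Prop :=
  irreflexive e /\ symmetric e.

Definition edge_set (T : finType) (e : rel T) : {set {set T}} :=
  [set E : {set T} | [exists x, exists y, e x y && (E == [set x; y])]].

Definition nedges (T : finType) (e : rel T) : nat := #|edge_set e|.

Definition is_orientation (T : finType) (e : rel T) (o : rel T) : Prop :=
  (forall x y, o x y -> e x y) /\ (forall x y, e x y -> o x y (+) o y x).

Definition invert (T : finType) (X : {set T}) (o : rel T) : rel T :=
  fun x y => if (x \in X) && (y \in X) then o y x else o x y.

Definition apply_inversions (T : finType) (o : rel T) (Xs : seq {set T}) : rel T :=
  foldl (fun o' X => invert X o') o Xs.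

Definition ceil_div (m q : nat) : nat := (m + q.-1) %/ q.

(* id^{<=p}(G) <= ceil(|E(G)| / floor(p/2)) + c holds for every graph G. *)
Definition Psi_bound (p : nat) (c : int) : Prop :=
  forall (T : finType) (e : rel T), simple_graph e ->
  forall o1 o2 : rel T, is_orientation e o1 -> is_orientation e o2 ->
  exists Xs : seq {set T},
    [/\ ((size Xs)%:Z <= (ceil_div (nedges e) p./2)%:Z + c)%R,
        all (fun X : {set T} => #|X| <= p) Xs &
        apply_inversions o1 Xs =2 o2].

Definition is_Psi (p : nat) (c : int) : Prop :=
  Psi_bound p c /\ (forall c' : int, Psi_bound p c' -> (c <= c')%R).

(* Main.v *)
Require Import Defs.
From mathcomp Require Import all_boot all_algebra.
From mathcomp Require Import zify.
Set Implicit Arguments. Unset Strict Implicit. Unset Printing Implicit Defensive.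

(** Let F be the set of edges on which the two orientations differ, q = floor(p/2) and m
    the number of edges. Once every edge at a set S of vertices is settled, S can be
    deleted, so it suffices to keep finding k inversions that settle at least q k edges.

    - A vertex v of degree d is settled by ceil(d/(2q-1)) inversions {v} + A with A among its
      F-neighbours, which is good enough when d >= q; and a vertex without F-edges is free.
      So the maximum degree may be assumed to be less than q. This settles q = 1, and q = 2
      because a matching is settled q edges at a time.
    - Two vertices whose common neighbours agree on F, and which are non-adjacent or joined
      by an F-edge, are settled by one inversion. For q = 3 and for q = 4 with maximum
      degree 2 this fails only when nearly all edges lie within distance 2 of a vertex of
      degree 2, leaving a few edges that the additional inversion takes care of.
    - For q = 4 and a vertex v of degree 3, deleting v alone is good enough unless 4 divides
      m. If no pair as above exists, every vertex is within distance 2 of v through a path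
      exactly one edge of which is in F, and F-edges at v lie in triangles or end in leaves.
      This leaves at most 8 vertices, hence m is 4, 8 or 12; double counting such paths
      excludes 12, and for 4 and 8 direct constructions work.

    The path with three edges shows that one additional inversion is needed for q >= 3. *)

(** * Inversions as parities, and rounding in the bound *)

Definition parity (T : finType) (Xs : seq {set T}) (x y : T) : bool :=
  odd (count (fun X : {set T} => (x \in X) && (y \in X)) Xs).

(** Inversions commute, so only the parity of the number of sets containing both ends matters. *)
Lemma apply_inversionsE (T : finType) (Xs : seq {set T}) (o : rel T) x y :
  apply_inversions o Xs x y = if parity Xs x y then o y x else o x y.
Proof.
elim: Xs o => [|X Xs IH] o //=; rewrite /apply_inversions /= in IH *.
rewrite IH /parity /= oddD /invert [(y \in X) && _]andbC.
by case: (_ && _); case: (odd _).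
Qed.

(** Used to show that [k] inversions settling [k * q] edges pay for themselves. *)
Lemma leq_ceil_divl m q k : 0 < q -> k * q <= m -> k + ceil_div (m - k * q) q <= ceil_div m q.
Proof.
move=> q0 le; rewrite /ceil_div -{2}(subnK le) addnAC addnC.
by rewrite [in X in _ <= X]addnC divnMDl // addnC.
Qed.

Lemma leq_ceil_div m n q : m <= n -> ceil_div m q <= ceil_div n q.
Proof. by move=> le; rewrite leq_div2r // leq_add2r. Qed.

(** * Degrees, edge counts and vertex deletion *)

Section Graph.
Variable T : finType.
Implicit Types (e F : rel T) (S X : {set T}).

Definition nbhd e x : {set T} := [set y | e x y].
Definition deg e x := #|nbhd e x|.
Definition fnbhd e F x : {set T} := [set y | e x y && F x y].
Definition del S e : rel T := fun x y => [&& x \notin S, y \notin S & e x y].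

Lemma degE e x : deg e x = \sum_y e x y.
Proof.
rewrite /deg -sum1_card big_mkcond; apply: eq_bigr => y _.
by rewrite inE; case: (e x y).
Qed.

Lemma handshake e : simple_graph e -> \sum_x deg e x = (nedges e).*2.
Proof.
move=> [irr sym].
have degI x : deg e x = \sum_(E in edge_set e) (x \in E).
  transitivity #|[set E in edge_set e | x \in E]|; last first.
    rewrite -sum1_card [RHS]big_mkcond [LHS]big_mkcond; apply: eq_bigr => E _.
    by rewrite inE; case: (E \in _); case: (x \in E).
  rewrite /deg -(card_in_imset (f := fun y => [set x; y])) => [|y z].
    apply: eq_card => E; rewrite !inE; apply/imsetP/andP => [[y]|[]].
      rewrite inE => exy ->; rewrite !inE eqxx; split=> //.
      by apply/existsP; exists x; apply/existsP; exists y; rewrite exy eqxx.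
    case/existsP=> a /existsP[b /andP[eab /eqP ->]]; rewrite !inE.
    case/orP=> /eqP ->; first by exists b; rewrite ?inE.
    by exists a; rewrite ?inE 1?sym // setUC.
  rewrite !inE => exy exz /setP/(_ y); rewrite !inE eqxx orbT.
  by case/esym/orP => /eqP // yx; rewrite yx irr in exy.
under eq_bigr do rewrite degI.
rewrite exchange_big /= -muln2 -sum_nat_const; apply: eq_bigr => E.
rewrite inE => /existsP[a /existsP[b /andP[eab /eqP ->]]].
have -> : \sum_x (x \in [set a; b]) = #|[set a; b]|.
  by rewrite -sum1_card [RHS]big_mkcond; apply: eq_bigr => x _; case: (x \in _).
by rewrite cards2; case: eqP eab => [->|//]; rewrite irr.
Qed.

Lemma simple_del S e : simple_graph e -> simple_graph (del S e).
Proof.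
case=> irr sym; split=> [x|x y]; rewrite /del ?irr ?andbF // sym.
by case: (x \in S); case: (y \in S).
Qed.

(** Doubling counts ordered pairs: with [a], [b] the indicators of [x \in S], [y \in S], the
    identity [1 + ab = (1 - a)(1 - b) + a + b] is summed over adjacent pairs. *)
Lemma nedges_del S e : simple_graph e ->
  (nedges e).*2 + \sum_(x in S) \sum_(y in S) e x y =
  (nedges (del S e)).*2 + (\sum_(x in S) deg e x).*2.
Proof.
move=> sg; rewrite -!handshake //; last exact: simple_del.
under [in LHS]eq_bigr do rewrite degE.
rewrite -addnn addnA.
under [in RHS]eq_bigr do rewrite degE.
have -> : \sum_(x in S) deg e x = \sum_x \sum_y (x \in S) && e x y.
  rewrite big_mkcond; apply: eq_bigr => x _; rewrite degE.
  by case: (x \in S) => //; rewrite big1.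
have {2}-> : \sum_x \sum_y (x \in S) && e x y = \sum_x \sum_y (y \in S) && e x y.
  by rewrite exchange_big /=; do 2!apply: eq_bigr => ? _; rewrite sg.2.
have -> : \sum_(x in S) \sum_(y in S) e x y = \sum_x \sum_y [&& x \in S, y \in S & e x y].
  rewrite big_mkcond; apply: eq_bigr => x _.
  case: (x \in S) => //; last by rewrite big1.
  by rewrite big_mkcond; apply: eq_bigr => y _; case: (y \in S).
rewrite -!big_split /=; apply: eq_bigr => x _.
rewrite -!big_split /=; apply: eq_bigr => y _.
by rewrite /del; case: (x \in S); case: (y \in S); case: (e x y).
Qed.

Lemma nedges_del1 v e : simple_graph e -> nedges (del [set v] e) + deg e v = nedges e.
Proof.
move=> sg; have := nedges_del [set v] sg; rewrite !big_set1 sg.1; lia.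
Qed.

Lemma nedges_del2 u v e : simple_graph e -> u != v ->
  nedges (del [set u; v] e) + deg e u + deg e v = nedges e + e u v.
Proof.
move=> sg uv; have := nedges_del [set u; v] sg.
rewrite !big_setU1 ?inE //= !big_set1 !big_setU1 ?inE //= !big_set1 !sg.1 (sg.2 v u); lia.
Qed.

Lemma nedges_del_indep S e : simple_graph e -> {in S &, forall x y, ~~ e x y} ->
  nedges (del S e) + \sum_(x in S) deg e x = nedges e.
Proof.
move=> sg ind; have := nedges_del S sg; rewrite big1; first by lia.
move=> x xS; rewrite big1 // => y yS; apply/eqP; rewrite eqb0; exact: ind.
Qed.

Lemma deg_del S e x : deg (del S e) x <= deg e x.
Proof. by apply/subset_leq_card/subsetP => y; rewrite !inE => /and3P[]. Qed.

Lemma deg_le_nedges e x : simple_graph e -> deg e x <= nedges e.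
Proof. by move=> sg; rewrite -(nedges_del1 x sg) leq_addl. Qed.

(** * Settling the edges at a vertex or at a set *)

(* F is the set of edges of e still to be flipped; its values off e are irrelevant. *)
Definition solvable p e F k := exists Xs : seq {set T},
  [/\ size Xs <= k, all (fun X : {set T} => #|X| <= p) Xs &
      forall x y, e x y -> parity Xs x y = F x y].

Lemma solvable_leq p e F k k' : k <= k' -> solvable p e F k -> solvable p e F k'.
Proof. by move=> le [Xs [sz al eq]]; exists Xs; split=> //; apply: leq_trans le. Qed.

Lemma solvable0 p e F k : simple_graph e -> nedges e = 0 -> solvable p e F k.
Proof.
move=> sg m0; exists [::]; split=> // x y exy.
have := deg_le_nedges x sg; rewrite m0 /deg leqn0 cards_eq0 => /eqP/setP/(_ y).
by rewrite !inE exy.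
Qed.

Definition toggle X F : rel T := fun x y => F x y (+) ((x \in X) && (y \in X)).

Lemma toggle_sym X F : symmetric F -> symmetric (toggle X F).
Proof. by move=> sym x y; rewrite /toggle sym andbC. Qed.

Lemma solvable_toggle p e F k X : #|X| <= p ->
  solvable p e (toggle X F) k -> solvable p e F k.+1.
Proof.
move=> cX [Xs [sz al eq]]; exists (X :: Xs); split=> [//||x y exy] /=; first by rewrite cX.
have := eq x y exy; rewrite /parity /toggle /= oddD => ->.
by rewrite oddb addbC -addbA addbb addbF.
Qed.

(** Removing [S] from every inverted set changes nothing on edges avoiding [S] and flips no edge
    meeting [S]. *)
Lemma solvable_del p e F k S : simple_graph e -> symmetric F ->
  (forall s y, s \in S -> e s y -> ~~ F s y) ->
  solvable p (del S e) F k -> solvable p e F k.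
Proof.
move=> sg symF clean [Xs [sz al eq]]; exists [seq X :\: S | X <- Xs]; split.
- by rewrite size_map.
- rewrite all_map; apply: sub_all al => X /=; apply: leq_trans.
  exact/subset_leq_card/subsetDl.
move=> x y exy; rewrite /parity count_map.
case: (boolP (x \in S)) => xS.
  rewrite (negbTE (clean _ _ xS exy)) (eq_count (a2 := pred0)) ?count_pred0 //.
  by move=> X /=; rewrite !inE xS.
case: (boolP (y \in S)) => yS.
  rewrite symF (negbTE (clean _ _ yS _)) 1?sg.2 // (eq_count (a2 := pred0)) ?count_pred0 //.
  by move=> X /=; rewrite !inE yS !andbF.
rewrite -eq; last by rewrite /del xS yS.
by congr odd; apply: eq_count => X /=; rewrite !inE xS yS.
Qed.

(** Every [F] is allowed, because settling a vertex may change [F] elsewhere in the remaining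
    graph. *)
Definition solvable_all p e k := forall F, symmetric F -> solvable p e F k.

(** Each inversion takes [v] with up to [p.-1] flip-neighbours; edges among these change too, but
    they survive in [del [set v] e]. *)
Lemma vertex_step p e F k j v : simple_graph e -> symmetric F -> 0 < p ->
  #|fnbhd e F v| <= k * p.-1 ->
  solvable_all p (del [set v] e) j -> solvable p e F (k + j).
Proof.
move=> sg symF p0 + H; elim: k F symF => [|k IH] F symF le.
  rewrite add0n; apply: (solvable_del (S := [set v])) => //; last exact: H.
  move=> s y /set1P -> evy; apply/negP => Fvy.
  by move: le; rewrite leqn0 cards_eq0 => /eqP/setP/(_ y); rewrite !inE evy Fvy.
have [A AF cA] : exists2 A : {set T}, A \subset fnbhd e F v &
    #|A| = minn p.-1 #|fnbhd e F v|.
  exists [set x in take p.-1 (enum (fnbhd e F v))].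
    by apply/subsetP => x; rewrite inE => /mem_take; rewrite mem_enum.
  rewrite cardsE (card_uniqP _) ?take_uniq ?enum_uniq // size_take -cardE.
  by rewrite /minn.
have vA : v \notin A by apply/negP => /(subsetP AF); rewrite inE sg.1.
apply: (@solvable_toggle _ _ _ _ (v |: A)).
  by rewrite cardsU1 vA cA; lia.
apply: IH; first exact: toggle_sym.
have -> : fnbhd e (toggle (v |: A) F) v = fnbhd e F v :\: A.
  apply/setP => y; rewrite !inE /toggle !inE eqxx /=.
  have [->|yv] := eqVneq y v; first by rewrite sg.1 andbF.
  have /implyP/= := subsetP AF y; rewrite !inE /=.
  by case: (y \in A) => //=; rewrite ?addbF //; case: (e v y) => //=; case: (F v y).
rewrite cardsDS // cA leq_subLR; move: le; rewrite mulSn.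
by case: (leqP p.-1 #|fnbhd e F v|) => // _ _; apply: leq_addr.
Qed.

(* Exactly the condition under which inverting S together with all the flip-neighbours
   of S settles every edge meeting S at once. *)
Definition compatible e F S := {in S &, forall s t,
  (e s t -> F s t) /\ forall w, e s w -> F s w -> e t w -> F t w}.

Lemma set_step p e F j S : simple_graph e -> symmetric F -> compatible e F S ->
  #|S| + \sum_(s in S) #|fnbhd e F s| <= p ->
  solvable_all p (del S e) j -> solvable p e F j.+1.
Proof.
move=> sg symF comp le H.
pose X := S :|: \bigcup_(s in S) fnbhd e F s.
apply: (@solvable_toggle _ _ _ _ X).
  apply: leq_trans le; apply: leq_trans (leq_card_setU _ _) _.
  rewrite leq_add2l; elim/big_rec2: _ => [|i n B _ leBn]; first by rewrite cards0.
  by apply: leq_trans (leq_card_setU _ _) _; rewrite leq_add2l.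
apply: (solvable_del (S := S)) => //; first exact: toggle_sym; last exact/H/toggle_sym.
move=> s y sS esy; rewrite /toggle (subsetP (subsetUl _ _) _ sS) /= addbC.
(* Since [s] lies in [X], the inversion flips the edge [s y] exactly when [y] lies in [X]. *)
suff -> : (y \in X) = F s y by rewrite addbb.
apply/setUP/idP => [[yS|/bigcupP[t tS]]|Fsy].
- by case: (comp s y sS yS) => /(_ esy).
- by rewrite inE => /andP[ety Fty]; case: (comp t s tS sS) => _ /(_ y); apply.
- by right; apply/bigcupP; exists s; rewrite // inE esy.
Qed.

Lemma fnbhd_deg e F v : #|fnbhd e F v| <= deg e v.
Proof. by apply/subset_leq_card/subsetP => y; rewrite !inE => /andP[]. Qed.

(** * Pairs of vertices, and the closed ball [near] of radius 2 *)

Definition near e v : {set T} := v |: nbhd e v :|: \bigcup_(w in nbhd e v) nbhd e w.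

Lemma pair_step p e F j u v : simple_graph e -> symmetric F -> u != v ->
  (e u v -> F u v) -> (forall w, e u w -> e v w -> F u w = F v w) ->
  #|fnbhd e F u| + #|fnbhd e F v| + 2 <= p ->
  solvable_all p (del [set u; v] e) j -> solvable p e F j.+1.
Proof.
move=> sg symF uv adj agree le; apply: set_step => //; last first.
  by rewrite big_setU1 ?inE //= big_set1 cards2 uv addnC.
move=> s t /set2P[]-> /set2P[]->; split=> //; rewrite ?sg.1 //.
- by move=> w euw Fuw evw; rewrite -agree.
- by rewrite sg.2 symF.
- by move=> w evw Fvw euw; rewrite agree.
Qed.

Lemma far_pair_step p e F j u v : simple_graph e -> symmetric F -> v \notin near e u ->
  #|fnbhd e F u| + #|fnbhd e F v| + 2 <= p ->
  solvable_all p (del [set u; v] e) j -> solvable p e F j.+1.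
Proof.
move=> sg symF; rewrite !inE !negb_or => /andP[/andP[vu nuv] far].
apply: pair_step => //; first by rewrite eq_sym.
  by move=> euv; rewrite euv in nuv.
move=> w euw evw; case/bigcupP: far; exists w; rewrite ?inE //.
by rewrite sg.2.
Qed.

Lemma card_near e v : 
  #|near e v| <= 1 + deg e v + \sum_(w in nbhd e v) #|nbhd e w :\: (v |: nbhd e v)|.
Proof.
have -> : near e v = (v |: nbhd e v) :|: \bigcup_(w in nbhd e v) (nbhd e w :\: (v |: nbhd e v)).
  apply/setP => y; rewrite /near [in LHS]in_setU [in RHS]in_setU.
  case: (boolP (y \in v |: nbhd e v)) => //= ny.
  apply/bigcupP/bigcupP => -[w wv yw]; exists w => //; first by rewrite in_setD ny.
  by move: yw; rewrite in_setD => /andP[].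
apply: leq_trans (leq_card_setU _ _) _; apply: leq_add.
  by rewrite cardsU1 leq_add2r leq_b1.
elim/big_rec2: _ => [|i n B _ leBn]; first by rewrite cards0.
by apply: leq_trans (leq_card_setU _ _) _; rewrite leq_add2l.
Qed.

(** The inequality is strict because the neighbour [v] of [w] lies in neither set on the left. *)
Lemma card_second_nbhd e v w : simple_graph e -> e v w ->
  #|nbhd e w :\: (v |: nbhd e v)| + #|nbhd e w :&: nbhd e v| < deg e w.
Proof.
move=> sg evw; rewrite -setDDl /deg.
have vw : v \in nbhd e w by rewrite inE sg.2.
rewrite (cardsD1 v (nbhd e w)) vw add1n ltnS.
have -> : nbhd e w :&: nbhd e v = (nbhd e w :\ v) :&: nbhd e v.
  by apply/setP => y; rewrite !inE; case: eqP => // ->; rewrite sg.1 andbF.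
by rewrite addnC cardsID.
Qed.

Definition noniso e : {set T} := [set x | 0 < deg e x].

Lemma noniso_adj e x y : e x y -> x \in noniso e.
Proof. by move=> exy; rewrite inE card_gt0; apply/set0Pn; exists y; rewrite inE. Qed.

(** Caps the number of edges once all non-isolated vertices lie in a small ball. *)
Lemma nedges_noniso e d : simple_graph e -> (forall x, deg e x <= d) ->
  (nedges e).*2 <= #|noniso e| * d.
Proof.
move=> sg le; rewrite -handshake // -sum_nat_const big_mkcond [leqRHS]big_mkcond /=.
rewrite [leqRHS]big_mkcond; apply: leq_sum => x _; rewrite inE.
by case: posnP => [->|_].
Qed.

(** * Induction on the number of edges, reducing to degrees below [q] *)

Definition bounded q c e := solvable_all q.*2 e (ceil_div (nedges e) q + c).

Lemma bounded_induction q c : 0 < q ->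
  (forall e F, simple_graph e -> symmetric F ->
     (forall e', simple_graph e' -> nedges e' < nedges e -> bounded q c e') ->
     (forall v, deg e v < q) -> (forall v, 0 < deg e v -> 0 < #|fnbhd e F v|) ->
     solvable q.*2 e F (ceil_div (nedges e) q + c)) ->
  forall e, simple_graph e -> bounded q c e.
Proof.
move=> q0 H e; have [n] := ubnP (nedges e); elim: n e => // n IHn e lt sg F symF.
have IH e' : simple_graph e' -> nedges e' < nedges e -> bounded q c e'.
  by move=> sg' lt'; apply: IHn => //; apply: leq_trans lt' _.
have [/existsP[v dv]|/existsPn small] := boolP [exists v, q <= deg e v].
  have eqm := nedges_del1 v sg.
  pose k := ceil_div (deg e v) q.*2.-1.
  have [le1 le2] : deg e v <= k * q.*2.-1 /\ k * q <= deg e v.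
    rewrite /k /ceil_div; move: (deg e v) dv => d dv.
    have := divn_eq (d + q.*2.-1.-1) q.*2.-1; have := ltn_pmod (d + q.*2.-1.-1) (d := q.*2.-1).
    set a := _ %/ _; set b := _ %% _ => /(_ _)/wrap[]; first by lia.
    move=> ltb eqd; split; first by lia.
    (* Below [2q] one inversion is enough and [q <= d]. From [2q] on, [a (2q - 1) <= d + 2q - 2];
       after multiplying by [q] it remains that [(q - 1) 2q <= (q - 1) d]. *)
    have [small|big] := ltnP d q.*2.
      suff : a < 2 by move: dv; case: a {eqd} => [|[]] //; lia.
      by rewrite -(@ltn_pmul2r q.*2.-1); lia.
    rewrite -(@leq_pmul2l q.*2.-1); last by lia.
    have : q * (a * q.*2.-1) <= q * (d + q.*2.-1.-1) by rewrite leq_mul2l eqd leq_addr orbT.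
    have : q.-1 * q.*2 <= q.-1 * d by rewrite leq_mul2l big orbT.
    case: (q) q0 => // r _; have -> : r.+1.*2.-1 = r * 2 + 1 by lia.
    have -> : (r * 2 + 1).-1 = r * 2 by lia.
    by rewrite -muln2 /=; lia.
  apply: (@solvable_leq _ _ _ (k + (ceil_div (nedges (del [set v] e)) q + c))).
    rewrite addnA leq_add2r.
    apply: leq_trans (leq_ceil_divl q0 (_ : k * q <= nedges e)); last by lia.
    by rewrite leq_add2l leq_ceil_div //; lia.
  apply: (vertex_step (v := v)) => //; first by lia.
    exact: leq_trans (fnbhd_deg _ _ _) le1.
  by apply: IH; [exact: simple_del | lia].
have [/existsP[v /andP[dv fv]]|/existsPn full] :=
    boolP [exists v, (0 < deg e v) && (#|fnbhd e F v| == 0)].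
  have eqm := nedges_del1 v sg.
  apply: (@solvable_leq _ _ _ (0 + (ceil_div (nedges (del [set v] e)) q + c))).
    by rewrite add0n leq_add2r leq_ceil_div //; lia.
  apply: (vertex_step (v := v)) => //; [lia | by rewrite (eqP fv) | ].
  by apply: IH; [exact: simple_del | lia].
apply: H => // v; first by rewrite ltnNge small.
by move=> dv; have := full v; rewrite dv lt0n.
Qed.

(** * Matchings, tiny graphs and the size of balls *)

(** Greedy choice: the [k] vertices chosen so far and their partners number at most [2k], fewer than
    the non-isolated vertices. *)
Lemma matching_transversal e k : simple_graph e -> (forall x, deg e x <= 1) -> k <= nedges e ->
  exists S : {set T}, [/\ #|S| = k, {in S, forall x, deg e x = 1} & {in S &, forall x y, ~~ e x y}].
Proof.
move=> sg le1; elim: k => [|k IH] lek; first by exists set0; split=> [|x|x y]; rewrite ?cards0 ?inE.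
have [S [cS dS iS]] := IH (ltnW lek).
have : ~~ (noniso e \subset S :|: \bigcup_(s in S) nbhd e s).
  apply/negP => /subset_leq_card; apply/negP; rewrite -ltnNge.
  apply: leq_trans (leq_trans _ (nedges_noniso sg le1)) _; last by rewrite muln1.
  apply: leq_ltn_trans (leq_card_setU _ _) _.
  suff : #|\bigcup_(s in S) nbhd e s| <= \sum_(s in S) 1.
    by rewrite sum1_card cS; lia.
  elim/big_rec2: _ => [|i n B _ leBn]; first by rewrite cards0.
  by apply: leq_trans (leq_card_setU _ _) _; rewrite leq_add //; apply: le1.
case/subsetPn => x; rewrite !inE negb_or => dx /andP[xS xN].
have nx s : s \in S -> ~~ e s x.
  by move=> sS; apply: contra xN => esx; apply/bigcupP; exists s; rewrite ?inE.
exists (x |: S); split=> [|y /setU1P[->|/dS//]|y z /setU1P[->|yS] /setU1P[->|zS]].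
- by rewrite cardsU1 xS cS.
- by have := le1 x; lia.
- by rewrite sg.1.
- by rewrite sg.2 nx.
- exact: nx.
- exact: iS.
Qed.

(** One inversion settles up to [q] edges: one end of each, plus the other end where a flip is due,
    makes at most [2q] vertices. *)
Lemma matching_bounded q e : 0 < q -> simple_graph e -> (forall x, deg e x <= 1) -> bounded q 0 e.
Proof.
move=> q0; have [n] := ubnP (nedges e); elim: n e => // n IH e lt sg le1 F symF.
have [m0|m0] := posnP (nedges e); first exact: solvable0.
have [S [cS dS iS]] := matching_transversal sg le1 (geq_minr q (nedges e)).
have eqm : nedges (del S e) + minn q (nedges e) = nedges e.
  have := nedges_del_indep sg iS; rewrite (eq_bigr (fun=> 1)) => [|x /dS//].
  by rewrite sum1_card cS.
apply: (@solvable_leq _ _ _ (ceil_div (nedges (del S e)) q).+1).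
  rewrite addn0 /ceil_div; case: (leqP q (nedges e)) => [le|lt'].
    rewrite -add1n; apply: leq_trans (leq_ceil_divl q0 (_ : 1 * q <= nedges e)); last by lia.
    by rewrite leq_add2l leq_ceil_div //; lia.
  have -> : nedges (del S e) = 0 by lia.
  by rewrite add0n divn_small ?divn_gt0 //; lia.
apply: (set_step (S := S)) => //.
- move=> s t sS tS; split=> [est|w esw Fsw etw]; first by have := iS s t sS tS; rewrite est.
  suff -> : t = s by [].
  have /card_le1_eqP : #|nbhd e w| <= 1 by apply: le1.
  by apply; rewrite inE sg.2.
- apply: (@leq_trans (#|S| + #|S|)); last by lia.
  rewrite leq_add2l -sum1_card leq_sum // => s sS.
  by rewrite -(dS _ sS) fnbhd_deg.
move=> F' symF'; rewrite -[ceil_div _ _]addn0; apply: IH => //.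
- by lia.
- exact: simple_del.
- by move=> x; apply: leq_trans (deg_del _ _ _) _.
Qed.

Lemma two_edges_solvable q e : 1 < q -> simple_graph e -> nedges e <= 2 -> solvable_all q.*2 e 1.
Proof.
move=> q1 sg m2 F symF.
have [/existsP[v dv]|/existsPn small] := boolP [exists v, 1 < deg e v].
  have eqm := nedges_del1 v sg.
  apply: (vertex_step (k := 1) (j := 0) (v := v)) => //; first by lia.
    by have := fnbhd_deg e F v; have := deg_le_nedges v sg; lia.
  by move=> F' symF'; apply: solvable0; [exact: simple_del|lia].
apply: solvable_leq (matching_bounded (q := q) _ sg _ symF); [|lia|]; last first.
  by move=> x; rewrite leqNgt small.
by rewrite addn0 /ceil_div -ltnS ltn_divLR; lia.
Qed.

Lemma deg_del1 u v e : simple_graph e -> u != v -> deg (del [set v] e) u + e u v = deg e u.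
Proof.
move=> sg uv; rewrite /deg (cardsD1 v (nbhd e u)) inE addnC; congr (_ + _).
by apply: eq_card => y; rewrite !inE /del !inE uv.
Qed.

(** The right side is the size of a tree-like ball; each neighbour [w] loses one vertex per triangle
    on [v w] and one per unit of missing degree. *)
Lemma card_near_excess e d v : simple_graph e -> (forall x, deg e x <= d) ->
  #|near e v| + \sum_(w in nbhd e v) (#|nbhd e w :&: nbhd e v| + (d - deg e w))
  <= 1 + deg e v + deg e v * d.-1.
Proof.
move=> sg le; apply: leq_trans (leq_add (card_near e v) (leqnn _)) _.
rewrite -addnA leq_add2l -big_split -sum_nat_const leq_sum //= => w.
by rewrite inE => evw; have := card_second_nbhd sg evw; have := le w; lia.
Qed.

(** The triangle is a loss at both [w] and [x], hence the 2. *)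
Lemma card_near_triangle e d v w x : simple_graph e -> (forall x, deg e x <= d) ->
  e v w -> e v x -> e w x -> #|near e v| + 2 <= 1 + deg e v + deg e v * d.-1.
Proof.
move=> sg le evw evx ewx; apply: leq_trans (card_near_excess v sg le).
rewrite leq_add2l (bigD1 w) ?inE //= (bigD1 x) /=; last first.
  by rewrite inE evx; apply: contraTneq ewx => ->; rewrite sg.1.
have : 0 < #|nbhd e w :&: nbhd e v| by rewrite card_gt0; apply/set0Pn; exists x; rewrite !inE ewx.
have : 0 < #|nbhd e x :&: nbhd e v|.
  by rewrite card_gt0; apply/set0Pn; exists w; rewrite !inE sg.2 ewx.
by lia.
Qed.

(** * The cases where [q] is 1, 2 or 3 *)

Lemma bounded1 e : simple_graph e -> bounded 1 0 e.
Proof.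
apply: bounded_induction => // {}e F sg symF _ small _; apply: solvable0 => //.
have := nedges_noniso (d := 0) sg; rewrite muln0 => /(_ (fun v => small v)); lia.
Qed.

Lemma bounded2 e : simple_graph e -> bounded 2 0 e.
Proof.
apply: bounded_induction => // {}e F sg symF _ small _.
by apply: matching_bounded.
Qed.

Lemma bounded_step q c e S F : simple_graph e -> symmetric F ->
  (forall e', simple_graph e' -> nedges e' < nedges e -> bounded q c e') ->
  nedges (del S e) < nedges e -> ceil_div (nedges (del S e)) q < ceil_div (nedges e) q ->
  (forall j, solvable_all q.*2 (del S e) j -> solvable q.*2 e F j.+1) ->
  solvable q.*2 e F (ceil_div (nedges e) q + c).
Proof.
move=> sg symF IH lt1 lt2 H.
apply: (@solvable_leq _ _ _ (ceil_div (nedges (del S e)) q + c).+1).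
  by rewrite -addSn leq_add2r.
by apply: H; apply: IH; first exact: simple_del.
Qed.

Lemma vertex_step1 q e F j v : simple_graph e -> symmetric F -> deg e v < q.*2 ->
  solvable_all q.*2 (del [set v] e) j -> solvable q.*2 e F j.+1.
Proof.
move=> sg symF dv; rewrite -add1n; apply: vertex_step => //; first by lia.
by have := fnbhd_deg e F v; lia.
Qed.

Lemma bounded3 e : simple_graph e -> bounded 3 1 e.
Proof.
apply: bounded_induction => // {}e F sg symF IH small _.
have [/existsP[v dv]|/existsPn lt2] := boolP [exists v, deg e v == 2]; last first.
  apply: solvable_leq (matching_bounded (q := 3) _ sg _ symF) => //.
    by rewrite leq_add2l.
  by move=> x; have := lt2 x; have := small x; lia.
have eqm := nedges_del1 v sg.
have [/subsetP all_near|/subsetPn[y]] := boolP (noniso e \subset near e v).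
  have le2 x : deg e x <= 2 by have := small x.
  have m5 : nedges e <= 5.
    have := nedges_noniso sg le2; have := card_near_excess v sg le2.
    have : #|noniso e| <= #|near e v| by apply/subset_leq_card/subsetP.
    by rewrite (eqP dv); lia.
  (* Deleting the two edges at [v] lowers the ceiling for 2, 4 and 5 edges but not for 3; there the
     additional inversion is spent. *)
  have [m3|m3] := eqVneq (nedges e) 3.
    rewrite m3; apply: (vertex_step1 (v := v)) => //; first by lia.
    by apply: two_edges_solvable => //; [exact: simple_del|lia].
  apply: (bounded_step (S := [set v])) => //; rewrite /ceil_div; [lia|lia|].
  by move=> j; apply: vertex_step1 => //; lia.
rewrite inE => dy far.
have vy : v != y by apply: contraNneq far => <-; rewrite !inE eqxx.
have nvy : e v y = false by apply: contraNF far => evy; rewrite !inE evy orbT.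
have eqm2 := nedges_del2 sg vy; rewrite nvy in eqm2.
apply: (bounded_step (S := [set v; y])) => //; rewrite /ceil_div; [lia|lia|].
move=> j; apply: far_pair_step => //.
by have := fnbhd_deg e F v; have := fnbhd_deg e F y; have := small y; lia.
Qed.

(** * The case [q = 4] with maximum degree 2 *)

Lemma four_edges_solvable e : simple_graph e -> (forall x, deg e x <= 2) ->
  nedges e <= 4 -> solvable_all 4.*2 e 2.
Proof.
move=> sg le2 m4 F symF.
have [/existsP[v dv]|/existsPn lt2] := boolP [exists v, deg e v == 2]; last first.
  apply: solvable_leq (matching_bounded (q := 4) _ sg _ symF) => //.
    by rewrite /ceil_div; lia.
  by move=> x; have := lt2 x; have := le2 x; lia.
have eqm := nedges_del1 v sg.
apply: (vertex_step1 (v := v)) => //; first by lia.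
by apply: two_edges_solvable => //; [exact: simple_del|lia].
Qed.

(** Unless some non-isolated vertex has no flip edge or the graph is a matching, a first inversion
    settles at least three edges at a pair and leaves at most two. *)
Lemma five_edges_solvable e : simple_graph e -> (forall x, deg e x <= 2) ->
  nedges e = 5 -> solvable_all 4.*2 e 2.
Proof.
move=> sg le2 m5 F symF.
have [/existsP[v /andP[dv fv]]|/existsPn full] :=
    boolP [exists v, (0 < deg e v) && (#|fnbhd e F v| == 0)].
  have eqm := nedges_del1 v sg.
  rewrite -[2]add0n; apply: (vertex_step (v := v)) => //; first by rewrite (eqP fv).
  apply: four_edges_solvable; [exact: simple_del| |lia].
  by move=> x; apply: leq_trans (deg_del _ _ _) _.
have [/existsP[u /eqP du]|/existsPn lt2] := boolP [exists v, deg e v == 2]; last first.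
  apply: solvable_leq (matching_bounded (q := 4) _ sg _ symF) => //.
    by rewrite m5.
  by move=> x; have := lt2 x; have := le2 x; lia.
have fle x := leq_trans (fnbhd_deg e F x) (le2 x).
have [/subset_leq_card all_near|/subsetPn[y]] := boolP (noniso e \subset near e u); last first.
  rewrite inE => dy far.
  have uy : u != y by apply: contraNneq far => <-; rewrite !inE eqxx.
  have nuy : e u y = false by apply: contraNF far => evy; rewrite !inE evy orbT.
  have eqm2 := nedges_del2 sg uy; rewrite nuy in eqm2.
  apply: (far_pair_step (u := u) (v := y)) => //; first by have := fle u; have := fle y; lia.
  by apply: two_edges_solvable => //; [exact: simple_del|lia].
(* Five edges need five non-isolated vertices, the most the ball can hold, so nothing may be lost:
   [w] has degree 2 and [u w] lies in no triangle. *)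
have cn := nedges_noniso sg le2.
have [w] : exists w, w \in fnbhd e F u.
  by apply/set0Pn; have := full u; rewrite du /= cards_eq0.
rewrite inE => /andP[euw Fuw].
have dw : deg e w = 2.
  have := card_near_excess u sg le2.
  rewrite (bigD1 w) ?inE //= du; have := le2 w; lia.
have uw : u != w by apply: contraTneq euw => ->; rewrite sg.1.
have eqm2 := nedges_del2 sg uw; rewrite euw in eqm2.
apply: (pair_step (u := u) (v := w)) => //.
- move=> x eux ewx; have := card_near_triangle sg le2 euw eux ewx.
  by rewrite du; lia.
- by have := fle u; have := fle w; lia.
by apply: two_edges_solvable => //; [exact: simple_del|lia].
Qed.

Lemma bounded4_deg2 e F : simple_graph e -> symmetric F ->
  (forall e', simple_graph e' -> nedges e' < nedges e -> bounded 4 1 e') ->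
  (forall v, deg e v <= 2) -> (forall v, 0 < deg e v -> 0 < #|fnbhd e F v|) ->
  solvable 4.*2 e F (ceil_div (nedges e) 4 + 1).
Proof.
move=> sg symF IH le2 full.
have [/existsP[v /eqP dv]|/existsPn lt2] := boolP [exists v, deg e v == 2]; last first.
  apply: solvable_leq (matching_bounded (q := 4) _ sg _ symF) => //.
    by rewrite leq_add2l.
  by move=> x; have := lt2 x; have := le2 x; lia.
have eqm := nedges_del1 v sg.
have fle x := leq_trans (fnbhd_deg e F x) (le2 x).
have [m4|m4] := leqP (nedges e) 4.
  apply: (@solvable_leq _ _ _ 2); first by rewrite /ceil_div; lia.
  apply: (vertex_step1 (v := v)) => //; first by lia.
  by apply: two_edges_solvable => //; [exact: simple_del|lia].
have [far0|/subsetPn[y yn far]] := boolP (noniso e \subset near e v).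
  have m5 : nedges e = 5.
    have := nedges_noniso sg le2; have := card_near_excess v sg le2.
    by have := subset_leq_card far0; rewrite dv; lia.
  apply: (bounded_step (S := [set v])) => //; rewrite /ceil_div; [lia|lia|].
  by move=> j; apply: vertex_step1 => //; lia.
have far_step y' : y' \in noniso e -> y' \notin near e v ->
    (nedges e + 3) %/ 4 > (nedges e - (2 + deg e y') + 3) %/ 4 ->
    solvable 4.*2 e F (ceil_div (nedges e) 4 + 1).
  move=> + far'; rewrite inE => dy.
  have vy : v != y' by apply: contraNneq far' => <-; rewrite !inE eqxx.
  have nvy : e v y' = false by apply: contraNF far' => evy; rewrite !inE evy orbT.
  have eqm2 := nedges_del2 sg vy; rewrite nvy in eqm2.
  move=> lt; apply: (bounded_step (S := [set v; y'])) => //; rewrite /ceil_div; [lia|lia|].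
  by move=> j; apply: far_pair_step => //; have := fle v; have := fle y'; lia.
(* Removing three edges lowers the ceiling unless 4 divides [nedges e]; in that case four must go at
   once. *)
have [m0|m0] := boolP (4 %| nedges e); last first.
  by apply: (far_step y) => //; move: yn; rewrite inE; lia.
have [/existsP[z /and3P[/eqP dz zn zfar]]|/existsPn far1] :=
  boolP [exists z, [&& deg e z == 2, z \in noniso e & z \notin near e v]].
  by apply: (far_step z) => //; lia.
have {}far1 z : z \in noniso e -> z \notin near e v -> deg e z = 1.
  by move=> zn zfar; have := far1 z; rewrite zn zfar; have := le2 z; move: zn; rewrite inE; lia.
(* Now there are at least 8 edges, hence 8 non-isolated vertices, against at most 5 in the ball and
   2 in [y] with its neighbour. *)
have [y2 y2n] : exists2 y2, y2 \in noniso e & y2 \notin near e v :|: (y |: nbhd e y).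
  apply/subsetPn/negP => /subset_leq_card.
  have := (leq_card_setU (near e v) (y |: nbhd e y)).1.
  have := (leq_card_setU [set y] (nbhd e y)).1.
  have := far1 y yn far; rewrite /deg cards1 => ->.
  have := nedges_noniso sg le2; have := card_near_excess v sg le2.
  by rewrite dv; lia.
rewrite in_setU negb_or in_setU1 negb_or => /and3P[far2 y2y]; rewrite inE => ny.
have [d1 d2] := (far1 y yn far, far1 y2 y2n far2).
have vneq z : z \notin near e v -> v != z by apply: contraNneq => <-; rewrite !inE eqxx.
have nadj z : z \notin near e v -> e v z = false.
  by apply: contraNF => evz; rewrite !inE evz orbT.
have nadj2 z w : z \notin near e v -> e v w -> e z w = false.
  move=> zfar evw; apply: contraNF zfar => ezw; rewrite in_setU; apply/orP; right.
  by apply/bigcupP; exists w; rewrite inE // sg.2.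
(* By [full] the only edge at a leaf is a flip edge, so two leaves with a common neighbour agree
   there. *)
have leafF z w : z \in noniso e -> deg e z = 1 -> e z w -> F z w.
  rewrite inE => zn dz ezw; have /set0Pn[x] : fnbhd e F z != set0.
    by rewrite -card_gt0 full.
  rewrite inE => /andP[ezx Fzx].
  have /card_le1_eqP : #|nbhd e z| <= 1 by rewrite -/(deg e z) dz.
  by move=> /(_ x w) ->; rewrite ?inE.
pose S := v |: [set y; y2].
have vS : v \notin [set y; y2] by rewrite !inE negb_or !vneq.
have sumS (f : T -> nat) : \sum_(s in S) f s = f v + (f y + f y2).
  by rewrite big_setU1 //= big_setU1 ?inE 1?eq_sym //= big_set1.
have indep : {in S &, forall s t, e s t = false}.
  move=> s t /setU1P[->|/set2P[]->] /setU1P[->|/set2P[]->]; rewrite ?sg.1 ?nadj //.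
  - by rewrite sg.2 nadj.
  - exact: negbTE.
  - by rewrite sg.2 nadj.
  - by rewrite sg.2; apply: negbTE.
have eqmS : nedges (del S e) + 4 = nedges e.
  rewrite -(@nedges_del_indep S e) // ?sumS ?dv ?d1 ?d2 // => s t sS tS.
  by rewrite indep.
apply: (bounded_step (S := S)) => //; rewrite /ceil_div; [lia|lia|].
move=> j; apply: set_step => //.
  move=> s t sS tS; split=> [|w esw Fsw etw]; first by rewrite indep.
  move: sS tS => /setU1P[sv|sy] /setU1P[tv|ty].
  - by rewrite tv -sv.
  - by rewrite sv in esw; case/set2P: ty etw => ->; rewrite nadj2.
  - by rewrite tv in etw; case/set2P: sy esw => ->; rewrite nadj2.
  - by case/set2P: ty etw => -> etw; apply: leafF.
rewrite sumS cardsU1 vS cards2 [y == y2]eq_sym y2y.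
have := fnbhd_deg e F y; have := fnbhd_deg e F y2; rewrite d1 d2; have := fle v; lia.
Qed.

(** * The case [q = 4] with a vertex of degree 3 *)

Definition disagree e F u x := [exists w, [&& e u w, e x w & F u w != F x w]].

Lemma disagree_near e F u x : simple_graph e -> disagree e F u x -> x \in near e u.
Proof.
move=> sg /existsP[w /and3P[euw exw _]]; rewrite in_setU; apply/orP; right.
by apply/bigcupP; exists w; rewrite inE // sg.2.
Qed.

(* No compatible pair containing a vertex of degree 3 meets four edges. *)
Definition rigid e F := forall u x, deg e u = 3 -> 0 < deg e x -> x != u ->
  (e u x -> F u x && (1 < deg e x)) -> disagree e F u x.

Lemma rigid_near e F u : simple_graph e -> rigid e F -> deg e u = 3 ->
  noniso e \subset near e u.
Proof.
move=> sg lck du; apply/subsetP => x; rewrite inE => dx.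
case: (boolP ((x == u) || e u x)) => [/orP[/eqP->|eux]|].
- by rewrite !inE eqxx.
- by rewrite !inE eux orbT.
rewrite negb_or => /andP[xu nux]; apply: (disagree_near (F := F)) => //.
by apply: lck => // eux; rewrite eux in nux.
Qed.

(** The ball has at most 10 vertices, and a flip-neighbour [w] of [u] costs two: a leaf by its
    missing degree, any other through the triangle that rigidity forces on [u w]. *)
Lemma rigid_noniso e F u : simple_graph e -> (forall x, deg e x <= 3) -> rigid e F ->
  deg e u = 3 -> 0 < #|fnbhd e F u| -> #|noniso e| <= 8.
Proof.
move=> sg le3 lck du; rewrite card_gt0 => /set0Pn[w]; rewrite inE => /andP[euw Fuw].
apply: leq_trans (subset_leq_card (rigid_near sg lck du)) _.
have [dw|dw] := leqP (deg e w) 1.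
  have := card_near_excess u sg le3.
  by rewrite (bigD1 w) ?inE //= du; lia.
have : disagree e F u w.
  apply: lck => //; first exact: ltnW.
    by apply: contraTneq euw => ->; rewrite sg.1.
  by rewrite Fuw dw.
case/existsP=> x /and3P[eux ewx _].
by have := card_near_triangle sg le3 euw eux ewx; rewrite du; lia.
Qed.

(** With [a] flip edges and [b] others at the centre there are [2ab] ordered pairs, at most 4 as
    [a + b <= 3]. *)
Lemma sum_disagree e F w : simple_graph e -> symmetric F -> deg e w <= 3 ->
  \sum_u \sum_x [&& e u w, e x w & F u w != F x w] <= 4 * (w \in noniso e).
Proof.
move=> sg symF le3.
pose P u : nat := e w u && F w u; pose Q u : nat := e w u && ~~ F w u.
have PQ : \sum_u P u + \sum_u Q u = deg e w.
  rewrite -big_split degE; apply: eq_bigr => u _; rewrite /P /Q.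
  by case: (e w u); case: (F w u).
rewrite (eq_bigr (fun u => \sum_x P u * Q x + \sum_x Q u * P x)); last first.
  move=> u _; rewrite -big_split; apply: eq_bigr => x _; rewrite /P /Q /=.
  rewrite ![e _ w]sg.2 ![F _ w]symF.
  by case: (e w u); case: (F w u); case: (e w x); case: (F w x).
rewrite big_split /= -!big_distrlr /= inE.
move: (\sum_u P u) (\sum_u Q u) PQ => a b PQ; case: posnP => /= d0.
  by have [-> ->] : a = 0 /\ b = 0 by lia.
have : a <= 3 by lia.
by case: a PQ => [|[|[|[|]]]] //=; lia.
Qed.

(* Double counting of disagreeing paths of length 2, as ordered pairs of ends: each vertex
   starts at least 5 of them but is the centre of at most 4. *)
Lemma rigid_not_cubic e F : simple_graph e -> symmetric F -> rigid e F ->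
  (forall v, 0 < deg e v -> 0 < #|fnbhd e F v|) ->
  (forall v, v \in noniso e -> deg e v = 3) -> #|noniso e| = 8 -> False.
Proof.
move=> sg symF lck full cub c8; set A := noniso e in cub c8.
have le3 x : deg e x <= 3 by have [->|dx] := posnP (deg e x); rewrite // cub // inE.
have lower u : u \in A -> 5 <= \sum_x disagree e F u x.
  move=> uA; have du := cub u uA.
  have /set0Pn[w] : fnbhd e F u != set0 by rewrite -card_gt0 full // du.
  rewrite inE => /andP[euw Fuw].
  have -> : \sum_x disagree e F u x = #|[set x | disagree e F u x]|.
    rewrite -sum1_card [RHS]big_mkcond; apply: eq_bigr => x _; rewrite inE.
    by case: (disagree _ _ _ _).
  have wA : w \in A by apply: (@noniso_adj e w u); rewrite sg.2.
  have dw := cub w wA.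
  (* Of the 8 vertices, 4 lie outside the closed neighbourhood of [u]; the flip-neighbour [w] is a
     fifth, and rigidity makes [u] disagree with each. *)
  apply: (@leq_trans #|w |: (A :\: (u |: nbhd e u))|); last first.
    apply/subset_leq_card/subsetP => x; rewrite !inE.
    case/orP=> [/eqP->|/andP[]].
      apply: lck => //; rewrite ?dw // ?Fuw //.
      by apply: contraTneq euw => ->; rewrite sg.1.
    rewrite negb_or => /andP[xu nux] dx; apply: lck => // eux.
    by rewrite eux in nux.
  rewrite cardsU1 !inE euw orbT /=.
  have := cardsID (u |: nbhd e u) A.
  have : #|A :&: (u |: nbhd e u)| <= #|u |: nbhd e u| by apply/subset_leq_card/subsetIr.
  have := (leq_card_setU [set u] (nbhd e u)).1.
  by rewrite cards1 -/(deg e u) du c8; lia.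
have : 5 * 8 <= \sum_(u in A) \sum_x disagree e F u x.
  by rewrite -c8 mulnC -sum_nat_const leq_sum.
suff : \sum_(u in A) \sum_x disagree e F u x <= 4 * 8 by lia.
apply: (@leq_trans (\sum_w 4 * (w \in A))); last first.
  rewrite -big_distrr /= leq_mul2l /= -c8 -sum1_card [leqRHS]big_mkcond /=.
  by apply: leq_sum => w _; case: (w \in A).
apply: (@leq_trans (\sum_w \sum_u \sum_x [&& e u w, e x w & F u w != F x w])); last first.
  by apply: leq_sum => w _; apply: sum_disagree.
rewrite [leqRHS]exchange_big [leqLHS]big_mkcond /=; apply: leq_sum => u _; case: ifP => // _.
rewrite [leqRHS]exchange_big /=; apply: leq_sum => x _.
case: (boolP (disagree e F u x)) => // /existsP[w Hw].
by rewrite (bigD1 w) //= Hw.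
Qed.

(** At least 12 edges on at most 8 non-isolated vertices of degree at most 3 force a cubic graph on
    8 vertices, which is excluded. *)
Lemma rigid_nedges e F v : simple_graph e -> symmetric F -> (forall x, deg e x <= 3) ->
  rigid e F -> (forall v, 0 < deg e v -> 0 < #|fnbhd e F v|) -> deg e v = 3 ->
  nedges e < 12.
Proof.
move=> sg symF le3 lck full dv.
have c8 := rigid_noniso sg le3 lck dv (full v _); rewrite dv in c8.
have m24 := nedges_noniso sg le3.
rewrite ltnNge; apply/negP => m12.
have {}c8 : #|noniso e| = 8 by have := c8 isT; lia.
apply: (rigid_not_cubic sg symF lck full) => // x xA.
have : \sum_(y in noniso e) (deg e y + (3 - deg e y)) = 24.
  by rewrite -[24]/(8 * 3) -c8 -sum_nat_const; apply: eq_bigr => y _; have := le3 y; lia.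
rewrite big_split /=.
have -> : \sum_(y in noniso e) deg e y = (nedges e).*2.
  rewrite -handshake // big_mkcond; apply: eq_bigr => y _; rewrite inE.
  by case: posnP.
rewrite (bigD1 x) //=; have := le3 x; lia.
Qed.

Lemma bounded4_deg3 e F v : simple_graph e -> symmetric F ->
  (forall e', simple_graph e' -> nedges e' < nedges e -> bounded 4 1 e') ->
  (forall v, deg e v <= 3) -> (forall v, 0 < deg e v -> 0 < #|fnbhd e F v|) ->
  deg e v = 3 -> solvable 4.*2 e F (ceil_div (nedges e) 4 + 1).
Proof.
move=> sg symF IH le3 full dv.
have eqm := nedges_del1 v sg.
have fle x := leq_trans (fnbhd_deg e F x) (le3 x).
have [m0|m0] := boolP (4 %| nedges e); last first.
  apply: (bounded_step (S := [set v])) => //; rewrite /ceil_div; [lia|lia|].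
  by move=> j; apply: vertex_step1 => //; lia.
have [/existsP[u /existsP[x /and5P[/eqP du dx xu /implyP eux dis]]]|/existsPn none] :=
  boolP [exists u, exists x, [&& deg e u == 3, 0 < deg e x, x != u,
     e u x ==> F u x && (1 < deg e x) & ~~ disagree e F u x]].
  rewrite eq_sym in xu; have eqm2 := nedges_del2 sg xu.
  (* The degrees sum to at least 4, and to at least 5 when the edge [u x] is counted twice. *)
  have m4 : nedges (del [set u; x] e) + 4 <= nedges e.
    by case: (e u x) eux eqm2 => [/(_ isT)/andP[_]|_]; lia.
  apply: (bounded_step (S := [set u; x])) => //; rewrite /ceil_div; [lia|lia|].
  move=> j; apply: pair_step => //.
  - by move=> /eux/andP[].
  - move=> w euw exw; apply/eqP; apply: contraNT dis => neq.
    by apply/existsP; exists w; rewrite euw exw.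
  - by have := fle u; have := fle x; lia.
have lck : rigid e F.
  move=> u x du dx xu eux; have /existsPn/(_ x) := none u.
  by rewrite du eqxx dx xu /= negb_and negbK => /orP[/negP[]|//]; apply/implyP.
have m12 := rigid_nedges sg symF le3 lck full dv.
have [m4|m8] : nedges e = 4 \/ nedges e = 8 by lia.
  rewrite m4; apply: (vertex_step1 (v := v)) => //; first by rewrite dv.
  by apply: two_edges_solvable => //; [exact: simple_del|lia].
rewrite m8; apply: (vertex_step1 (v := v)) => //; first by rewrite dv.
have sg' := simple_del [set v] sg.
(* Two inversions remain for five edges: a second vertex of degree 3 away from [v] leaves only two,
   and otherwise deleting [v] brings all degrees down to 2. *)
have [/existsP[u /and3P[uv nuv /eqP du]]|/existsPn none'] :=
  boolP [exists u, [&& u != v, ~~ e u v & deg e u == 3]].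
  have du' : deg (del [set v] e) u = 3.
    by have := deg_del1 sg uv; rewrite (negbTE nuv) addn0 du.
  move=> F' symF'; apply: (vertex_step1 (v := u)) => //; first by rewrite du'.
  have := nedges_del1 u sg'; rewrite du' => eqm'.
  by apply: two_edges_solvable => //; [exact: simple_del|lia].
apply: five_edges_solvable => //; last by lia.
move=> x; have [->|xv] := eqVneq x v.
  by rewrite /deg eq_card0 // => y; rewrite !inE /del !inE eqxx.
have := deg_del1 sg xv; have := none' x; have := le3 x; rewrite xv /=.
by case: (e x v) => /=; lia.
Qed.

Lemma bounded4 e : simple_graph e -> bounded 4 1 e.
Proof.
apply: bounded_induction => // {}e F sg symF IH small full.
have [/existsP[v /eqP dv]|/existsPn lt3] := boolP [exists v, deg e v == 3].
  by apply: (bounded4_deg3 (v := v)).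
by apply: bounded4_deg2 => // x; have := small x; have := lt3 x; lia.
Qed.
End Graph.

(** * From flip sets to orientations, and the lower bounds *)

Lemma bounded_Psi_bound p c :
  (forall (T : finType) (e : rel T), simple_graph e -> bounded p./2 c e) -> Psi_bound p c%:Z.
Proof.
move=> H T e sg o1 o2 [o1e o1x] [o2e o2x].
pose F x y := e x y && (o1 x y != o2 x y).
have symF : symmetric F.
  move=> x y; rewrite /F sg.2; case eyx: (e y x) => //=.
  have := o1x _ _ eyx; have := o2x _ _ eyx.
  by case: (o1 x y); case: (o1 y x); case: (o2 x y); case: (o2 y x).
have [Xs [sz al eq]] := H T e sg F symF.
exists Xs; split; first by lia.
  (* For odd [p] the sets are even smaller than allowed. *)
  by apply: sub_all al => X /= leX; apply: leq_trans leX _; lia.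
move=> x y; rewrite apply_inversionsE; case exy: (e x y).
  have := o1x _ _ exy; have := o2x _ _ exy; rewrite eq // /F exy /=.
  by case: (o1 x y); case: (o1 y x); case: (o2 x y); case: (o2 y x).
have N (o : rel T) : (forall a b, o a b -> e a b) -> (o x y = false) * (o y x = false).
  by move=> oe; split; apply/negP => /oe; rewrite ?exy // sg.2 exy.
by rewrite !(N o1) // (N o2) // if_same.
Qed.

(** Reversing a single edge takes an inversion, and [ceil_div] grants exactly one. *)
Lemma Psi_bound_ge0 p c : 1 < p -> Psi_bound p c -> (0 <= c)%R.
Proof.
move=> p1; pose e (x y : bool) := x != y.
have sg : simple_graph e by split=> [[]|[] []].
have m1 : nedges e = 1.
  by have := handshake sg; rewrite big_bool !degE !big_bool /= /e /=; lia.
case/(_ _ e sg (fun x y => x && ~~ y) (fun x y => ~~ x && y)) => [||Xs [+ _]].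
- by split=> [[] []|[] []].
- by split=> [[] []|[] []].
case: Xs => [|X Xs]; first by move=> _ /(_ true false).
move=> sz _; suff : ceil_div (nedges e) p./2 = 1 by move: sz => /=; lia.
rewrite m1 /ceil_div add1n prednK; last by lia.
by rewrite divnn; lia.
Qed.

(* On a path with three edges, flipping exactly the two end edges takes two inversions
   however large the inverted sets may be. *)
Lemma Psi_bound_ge1 p c : 5 < p -> Psi_bound p c -> (1 <= c)%R.
Proof.
move=> p5; pose o1 (i j : 'I_4) := i.+1 == j.
pose e (i j : 'I_4) := o1 i j || o1 j i.
(* Among the edges, [i + j == 3] singles out the middle one, which keeps its orientation. *)
pose o2 (i j : 'I_4) := if i + j == 3 then o1 i j else o1 j i.
have sg : simple_graph e.
  by split=> [i|i j]; [rewrite /e /o1; lia | rewrite /e orbC].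
have m3 : nedges e = 3.
  have := handshake sg.
  by rewrite !big_ord_recl big_ord0 !degE !big_ord_recl !big_ord0 /e /o1 /=; lia.
case/(_ _ e sg o1 o2) => [||Xs [sz _]].
- by split=> i j; rewrite /e /o1; lia.
- by split=> i j; rewrite /e /o2 /o1 1?[j + i]addnC; case: ifP; lia.
have c1 : ceil_div (nedges e) p./2 = 1.
  rewrite m3 /ceil_div; apply/eqP; rewrite eqn_leq -ltnS ltn_divLR ?divn_gt0; lia.
case: Xs sz => [|X [|Y Xs]] sz eq; last by move: sz; rewrite c1 /=; lia.
  by have := eq (@Ordinal 4 0 isT) (@Ordinal 4 1 isT).
(* Flipping both end edges puts all four vertices into [X], which flips the middle edge too. *)
have inX i j : (i \in X) && (j \in X) = parity [:: X] i j by rewrite /parity /= addn0 oddb.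
have := eq (@Ordinal 4 0 isT) (@Ordinal 4 1 isT); rewrite apply_inversionsE -inX.
have := eq (@Ordinal 4 1 isT) (@Ordinal 4 2 isT); rewrite apply_inversionsE -inX.
have := eq (@Ordinal 4 2 isT) (@Ordinal 4 3 isT); rewrite apply_inversionsE -inX.
by do 4 case: (_ \in X).
Qed.

Theorem mainTheorem2 :
  (forall p : nat, 2 <= p <= 5 -> is_Psi p 0) /\
  (forall p : nat, 6 <= p <= 9 -> is_Psi p 1).
Proof.
split=> p Hp; split.
- apply: (@bounded_Psi_bound p 0) => T e sg.
  have [->|->] : p./2 = 1 \/ p./2 = 2 by lia.
    exact: bounded1.
  exact: bounded2.
- by move=> c; apply: Psi_bound_ge0; lia.
- apply: (@bounded_Psi_bound p 1) => T e sg.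
  have [->|->] : p./2 = 3 \/ p./2 = 4 by lia.
    exact: bounded3.
  exact: bounded4.
- by move=> c; apply: Psi_bound_ge1; lia.
Qed.
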